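(* Let $\lambda,\mu\in DP$ with $D_\mu\subseteq D_\lambda$, and let $c(T_{\lambda/\mu})=\nu=(\nu_1,\ldots,\nu_n)$. Let $1\le k\le n+1$ and let $\alpha,\beta\in DP$ be such that $U_k(\lambda/\mu)$ has shape $D_{\alpha/\beta}$. Then for every $\gamma\in DP$ $$\prod_{j=1}^{k-1}2^{comp(P_j)-1}\; f^{\alpha}_{\beta\gamma}=f^{\lambda}_{\mu\,(\nu_1,\ldots,\nu_{k-1},\gamma_1,\ldots,\gamma_{\ell(\gamma)})}.$$ In particular, $f^{\alpha}_{\beta\gamma}\le f^{\lambda}_{\mu\,(\nu_1,\ldots,\nu_{k-1},\gamma_1,\ldots,\gamma_{\ell(\gamma)})}$.
   Context: $DP$ is the set of all partitions with distinct parts, i.e. finite strictly decreasing sequences $\lambda=(\lambda_1>\cdots>\lambda_{\ell(\lambda)}>0)$ of integers, including $\emptyset$. The (shifted) diagram is $D_\lambda=\{(i,j)\mid 1\le i\le \ell(\lambda),\ i\le j\le i+\lambda_i-1\}$ (matrix coordinates); if $D_\mu\subseteq D_\lambda$, $D_{\lambda/\mu}=D_\lambda\setminus D_\mu$. A set of boxes has shape $D_{\alpha/\beta}$ if it equals $D_{\alpha/\beta}$ up to a translation. For a set of boxes $D$, $comp(D)$ is the number of its edgewise connected components. Alphabet: $1'<1<2'<2<\cdots$. A tableau of shape $D_{\lambda/\mu}$ is a filling of the boxes by letters of this alphabet, weakly increasing along rows (left to right) and down columns, such that each column contains at most one unmarked $k$ and each row at most one marked $k'$, for every $k\ge 1$.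 Its content $c(T)=(c_1,c_2,\ldots)$ (trailing zeros omitted) has $c_i$ = total number of entries $i$ and $i'$. Salmasian's algorithm defines $T_{\lambda/\mu}$, $U_k$, $P_k$: put $U_1(\lambda/\mu)=D_{\lambda/\mu}$ and for $k=1,2,\ldots$ let $P_k=\{(x,y)\in U_k(\lambda/\mu)\mid (x-1,y-1)\notin U_k(\lambda/\mu)\}$ and $U_{k+1}(\lambda/\mu)=U_k(\lambda/\mu)\setminus P_k$. For $(x,y)\in P_k$ put $T_{\lambda/\mu}(x,y)=k'$ if $(x+1,y)\in P_k$, and $T_{\lambda/\mu}(x,y)=k$ otherwise. This is a tableau of shape $D_{\lambda/\mu}$. Amenability: the reading word $w(T)$ reads the rows from left to right, starting with the bottom row and ending with the top row. For a word $w=w_1\cdots w_n$ in the alphabet and $i\ge1$ set $m_i(0)=0$; for $1\le j\le n$, $m_i(j)$ is the number of letters $i$ in $w_{n-j+1}\cdots w_n$; for $n+1\le j\le 2n$, $m_i(j)=m_i(n)+$ the number of letters $i'$ in $w_1\cdots w_{j-n}$. The word is $k$-amenable if: (a) for $0\le j\le n-1$, if $m_k(j)=m_{k-1}(j)$ then $w_{n-j}\notin\{k,k'\}$; (b) for $n\le j\le 2n-1$, if $m_k(j)=m_{k-1}(j)$ then $w_{j-n+1}\notin\{k-1,k'\}$; (c) the leftmost letter of $w$ in $\{k',k\}$, if any, is $k$; (d) the leftmost letter of $w$ in $\{(k-1)',k-1\}$, if any, is $k-1$. The word is amenable if it is $k$-amenable for all $k>1$; a tableau is amenable if its reading word is.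 For a finite sequence $\kappa$ of positive integers, $f^\lambda_{\mu\kappa}$ is the number of amenable tableaux of shape $D_{\lambda/\mu}$ and content $\kappa$. *)

(* Defs.v *)
From HB Require Import structures.
From mathcomp Require Import all_boot all_order all_algebra.
From mathcomp Require Import finmap.
From mathcomp Require Import zify.
Set Implicit Arguments.
Unset Strict Implicit.
Unset Printing Implicit Defensive.
Import Order.TTheory GRing.Theory Num.Theory.
Local Open Scope fset_scope.
Local Open Scope nat_scope.

(* A partition lists its parts: lambda_i is la`_(i.-1). *)
Definition strict_partition (la : seq nat) : bool := sorted gtn la && (0 \notin la).

(* Boxes are (row, column), rows being numbered downwards.  The coordinates are
   integers so that translations and diagonal predecessors are total. *)
Definition box : Type := (int * int)%type.

Definition diagram (la : seq nat) : {fset box} :=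
  [fset b in [seq (i.+1%:Z, (i.+1 + j)%:Z)%R | i <- iota 0 (size la),
                                               j <- iota 0 (nth 0 la i)]].

Definition skew_diagram (la mu : seq nat) : {fset box} := diagram la `\` diagram mu.

Definition translate (a b : int) (D : {fset box}) : {fset box} :=
  [fset ((x.1 + a)%R, (x.2 + b)%R) | x in D].

Definition has_shape (D E : {fset box}) : Prop := exists a b : int, D = translate a b E.

Definition edge_adjacent (x y : box) : bool :=
  (`|x.1 - y.1| + `|x.2 - y.2| == 1)%N.

Definition num_components (D : {fset box}) : nat :=
  n_comp (fun x y : D => edge_adjacent (val x) (val y)) predT.

(* (k, false) is the unmarked letter k and (k, true) the marked letter k'. *)
Definition letter : Type := (nat * bool)%type.

Definition letter_le (l m : letter) : bool :=
  (l.1 < m.1) || (l.1 == m.1) && (m.2 ==> l.2).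

Definition max_value (w : seq letter) : nat := \max_(l <- w) l.1.

Definition is_tableau (D : {fset box}) (T : {ffun D -> letter}) : bool :=
  [&& [forall x, 0 < (T x).1],
      [forall x, forall y,
        ((val x).1 == (val y).1) && ((val x).2 <= (val y).2)%R ==> letter_le (T x) (T y)],
      [forall x, forall y,
        ((val x).2 == (val y).2) && ((val x).1 <= (val y).1)%R ==> letter_le (T x) (T y)],
      [forall x, forall y,
        [&& (val x).2 == (val y).2, T x == T y & ~~ (T x).2] ==> (x == y)]
    & [forall x, forall y,
        [&& (val x).1 == (val y).1, T x == T y & (T x).2] ==> (x == y)]].

Definition reading_le (x y : box) : bool :=
  (y.1 < x.1)%R || (x.1 == y.1) && (x.2 <= y.2)%R.

Definition reading_word (D : {fset box}) (T : {ffun D -> letter}) : seq letter :=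
  [seq T x | x <- sort (fun x y : D => reading_le (val x) (val y)) (enum {: D})].

(* The sequence stops at the largest value occurring in T, so that it has no
   trailing zeros. *)
Definition content (D : {fset box}) (T : {ffun D -> letter}) : seq nat :=
  mkseq (fun i => #|[pred x | (T x).1 == i.+1]|) (\max_x (T x).1).

Definition mstat (w : seq letter) (i j : nat) : nat :=
  let n := size w in
  if j <= n then count_mem (i, false) (drop (n - j) w)
  else count_mem (i, false) w + count_mem (i, true) (take (j - n) w).

Definition leftmost_unmarked (w : seq letter) (k : nat) : bool :=
  if [seq l <- w | l.1 == k] is l :: _ then l == (k, false) else true.

(* The letter w_p of the word w_1 ... w_n is nth _ w p.-1. *)
Definition k_amenable (k : nat) (w : seq letter) : bool :=
  let n := size w in
  let wj p := nth (0, false) w p.-1 in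
  [&& all (fun j => (mstat w k j == mstat w k.-1 j) ==>
             (wj (n - j) \notin [:: (k, true); (k, false)])) (iota 0 n),
      all (fun j => (mstat w k j == mstat w k.-1 j) ==>
             (wj (j - n).+1 \notin [:: (k.-1, false); (k, true)])) (iota n n),
      leftmost_unmarked w k
    & leftmost_unmarked w k.-1].

(* Amenability requires k-amenability for all k > 1; by amenableP it is enough
   to test the k up to one more than the largest value in w. *)
Definition amenable (w : seq letter) : bool :=
  all (fun k => k_amenable k w) (iota 2 (max_value w)).

Lemma amenableP (w : seq letter) :
  reflect (forall k : nat, 1 < k -> k_amenable k w) (amenable w).
Proof.
apply: (iffP allP) => [h k k1|h k]; last by rewrite mem_iota => /andP[/h].
have [kM|Mk] := leqP k (max_value w).+1; first by apply: h; rewrite mem_iota; lia.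
have small l : l \in w -> l.1 < k.-1.
  move=> lw; have : l.1 <= max_value w by exact: (@leq_bigmax_seq _ _ xpredT fst).
  by lia.
have notin p v : p < size w -> k.-1 <= v.1 -> nth (0, false) w p != v.
  by move=> /(mem_nth (0, false))/small; case: eqP => // ->; rewrite ltnNge => /negbTE ->.
have lm v : k.-1 <= v -> leftmost_unmarked w v.
  move=> kv; rewrite /leftmost_unmarked.
  suff -> : [seq l <- w | l.1 == v] = [::] by [].
  apply/eqP; rewrite -(negbK (_ == _)) -has_filter; apply/hasPn => l /small.
  by case: eqP => // ->; rewrite ltnNge kv.
apply/and4P; split; try by apply: lm; lia.
- apply/allP => j; rewrite mem_iota => hj; apply/implyP => _.
  by rewrite !inE negb_or !notin //=; lia.
- apply/allP => j; rewrite mem_iota => hj; apply/implyP => _.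
  by rewrite !inE negb_or !notin //=; lia.
Qed.

Definition widen_letters (m : nat) (D : {fset box}) (t : {ffun D -> 'I_m.+1 * bool}) :
  {ffun D -> letter} := [ffun x => (val (t x).1, (t x).2)].

(* f^la_(mu kappa).  The letters are taken in the finite alphabet of values at
   most size kappa; by content_widen this loses no filling of content kappa. *)
Definition amenable_count (la mu kappa : seq nat) : nat :=
  #|[set t : {ffun skew_diagram la mu -> 'I_(size kappa).+1 * bool} |
      let T := widen_letters t in
      [&& is_tableau T, amenable (reading_word T) & content T == kappa]]|.

Lemma widen_letters_inj (m : nat) (D : {fset box}) :
  injective (@widen_letters m D).
Proof.
move=> t u /ffunP e; apply/ffunP => x; have := e x; rewrite !ffunE.
by case: (t x) (u x) => [a b] [c d] /= [/val_inj -> ->].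
Qed.

Lemma content_widen (D : {fset box}) (T : {ffun D -> letter}) (kappa : seq nat) :
  content T = kappa ->
  exists t : {ffun D -> 'I_(size kappa).+1 * bool}, T = widen_letters t.
Proof.
move=> <-; rewrite size_mkseq.
exists [ffun x => (inord (T x).1, (T x).2)]; apply/ffunP => x.
rewrite !ffunE /= inordK; first by case: (T x).
by rewrite ltnS; exact: (leq_bigmax x).
Qed.

(* For U = U_k this is P_k. *)
Definition salmasian_front (U : {fset box}) : {fset box} :=
  [fset x in U | ((x.1 - 1)%R, (x.2 - 1)%R) \notin U].

(* Indexed from k = 1. *)
Definition salmasian_U (D : {fset box}) (k : nat) : {fset box} :=
  iter k.-1 (fun U => U `\` salmasian_front U) D.

Definition salmasian_P (D : {fset box}) (k : nat) : {fset box} :=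
  salmasian_front (salmasian_U D k).

(* For x in D, the unique k >= 1 with x in P_k; the bound #|D| on the search is
   large enough by salmasian_TE. *)
Definition salmasian_index (D : {fset box}) (x : box) : nat :=
  (find (fun i => x \in salmasian_P D i.+1) (iota 0 #|` D|)).+1.

Definition salmasian_T (D : {fset box}) : {ffun D -> letter} :=
  [ffun x : D => let k := salmasian_index D (val x) in
                 (k, ((val x).1 + 1, (val x).2)%R \in salmasian_P D k)].

Lemma salmasian_front_neq0 (U : {fset box}) : U != fset0 -> salmasian_front U != fset0.
Proof.
case/fset0Pn => x xU; apply/negP => /eqP F0.
have step y : y \in U -> ((y.1 - 1)%R, (y.2 - 1)%R) \in U.
  move=> yU; apply/negPn/negP => h.
  have : y \in salmasian_front U by rewrite !inE /= yU.
  by rewrite F0 inE.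
have orbit n : ((x.1 - n%:Z)%R, (x.2 - n%:Z)%R) \in U.
  elim: n => [|n /step /=]; first by rewrite !subr0 -surjective_pairing.
  have decr (a : int) : (a - n%:Z - 1 = a - n.+1%:Z)%R by lia.
  by rewrite !decr.
have : #|` [fset ((x.1 - n%:Z)%R, (x.2 - n%:Z)%R) | n in iota 0 #|` U|.+1] | <= #|` U|.
  by apply/fsubset_leq_card/fsubsetP => y /imfsetP[n _ ->].
rewrite card_imfset /=; last by move=> m n [] /= h _; lia.
by rewrite mem_iota /= undup_id ?iota_uniq //= size_iota ltnn.
Qed.

Lemma salmasian_U_card (D : {fset box}) (k : nat) :
  #|` salmasian_U D k.+1| + k <= #|` D| \/ salmasian_U D k.+1 = fset0.
Proof.
elim: k => [|k]; first by left; rewrite addn0.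
set U := salmasian_U D k.+1; have -> : salmasian_U D k.+2 = U `\` salmasian_front U by [].
have [->|U0] := eqVneq U fset0; first by rewrite fset0D; right.
case=> [h|h]; last by rewrite h eqxx in U0.
have sub : salmasian_front U `<=` U by apply/fsubsetP => y; rewrite !inE => /andP[].
left; have := salmasian_front_neq0 U0; rewrite -cardfs_gt0.
by rewrite cardfsDS //; have := fsubset_leq_card sub; lia.
Qed.

Lemma salmasian_TE (D : {fset box}) (k : nat) (x : D) :
  0 < k -> val x \in salmasian_P D k ->
  salmasian_T D x = (k, ((val x).1 + 1, (val x).2)%R \in salmasian_P D k).
Proof.
case: k => // k _ xP; rewrite ffunE /=.
suff -> : salmasian_index D (val x) = k.+1 by [].
have Usub i j : i <= j -> salmasian_U D j.+1 `<=` salmasian_U D i.+1.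
  elim: j => [|j IH]; first by rewrite leqn0 => /eqP->.
  rewrite leq_eqVlt => /orP[/eqP->//|/IH]; apply: fsubset_trans.
  exact: fsubsetDl.
have uniqP i j : i < j -> val x \in salmasian_P D i.+1 -> val x \notin salmasian_P D j.+1.
  move=> ij xi; apply/negP => xj; have : val x \in salmasian_U D j.+1.
    by move: xj; rewrite in_fset /= inE => /andP[].
  by move=> /(fsubsetP (Usub _ _ ij)); rewrite /= in_fsetD => /andP[/negP].
have kD : k < #|` D|.
  have xU : val x \in salmasian_U D k.+1 by move: xP; rewrite !inE => /andP[].
  have U0 : salmasian_U D k.+1 != fset0 by apply/fset0Pn; exists (val x).
  case: (salmasian_U_card D k) => [|/eqP]; last by rewrite (negbTE U0).
  by move: U0; rewrite -cardfs_gt0; lia.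
rewrite /salmasian_index; set p := fun i => _; congr S.
have hp : has p (iota 0 #|` D|) by apply/hasP; exists k; rewrite ?mem_iota.
have := nth_find 0 hp; have := hp; rewrite has_find size_iota => lt.
rewrite nth_iota // add0n => pf.
by have [/uniqP/(_ pf)|/uniqP/(_ xP)|//] := ltngtP (find p (iota 0 #|` D|)) k;
   rewrite ?xP // /p in pf *; rewrite pf.
Qed.

(* Main.v *)
Require Import Defs.
From mathcomp Require Import all_boot all_order all_algebra.
From mathcomp Require Import finmap zify.
Set Implicit Arguments.
Unset Strict Implicit.
Unset Printing Implicit Defensive.
Import Order.TTheory GRing.Theory Num.Theory.
Local Open Scope fset_scope.
Local Open Scope nat_scope.

(** In a tableau the entries strictly increase in value along diagonals, so each
    diagonal carries at most one letter in {1, 1'}, and it sits in the first box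
    of the diagonal.  If the number of these letters is the size of the front
    P_1, they therefore fill P_1 exactly, and the other letters, lowered by one,
    form a tableau of shape U_2.  The marks on the front are forced except at
    the lower left end of each of its components, and amenability forces the
    first of these ends in reading order to be unmarked: this is the factor
    2^(comp(P_1) - 1).  For k >= 3, k-amenability depends only on the part in U_2.
    2-amenability is automatic, by two injections from the letters 2, 2' to the
    letters 1, 1': a 2 or 2' in box (a, b) has a 1 or 1' in box (a - 1, b - 1),
    and an unmarked 1 strictly above it in column b.  Iterating over k gives the
    theorem. *)

(** * Amenability in terms of boxes *)

Definition reading_lt (x y : box) : bool := reading_le x y && (x != y).

Lemma reading_le_total : total reading_le.
Proof. by move=> [a b] [c d]; rewrite /reading_le /=; lia. Qed.

Lemma reading_le_trans : transitive reading_le.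
Proof. by move=> [a b] [c d] [e f]; rewrite /reading_le /=; lia. Qed.

Lemma box_eqE (p q : box) : (p == q) = (p.1 == q.1) && (p.2 == q.2).
Proof. by case: p q => [a b] [c d]; rewrite xpair_eqE. Qed.

Lemma reading_ltE (p q : box) :
  reading_lt p q = (q.1 < p.1)%R || (p.1 == q.1) && (p.2 < q.2)%R.
Proof. by rewrite /reading_lt /reading_le box_eqE; lia. Qed.

Lemma reading_ltxx (p : box) : reading_lt p p = false.
Proof. by rewrite /reading_lt eqxx andbF. Qed.

(** Labellings become functions on all boxes, so that a labelling of D and one of a subset of D can
    be compared without casts. The default letter does not matter, as the conditions below range
    over boxes of D. *)
Definition ext (D : {fset box}) (T : {ffun D -> letter}) (b : box) : letter :=
  if insub b is Some x then T x else (0, false).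

Lemma ext_val (D : {fset box}) (T : {ffun D -> letter}) (x : D) : ext T (val x) = T x.
Proof. by rewrite /ext valK. Qed.

Lemma ext_eq (D : {fset box}) (T T' : {ffun D -> letter}) :
  {in D, ext T =1 ext T'} -> T = T'.
Proof. by move=> e; apply/ffunP => x; rewrite -!ext_val e ?fsvalP. Qed.

Definition reading_seq (D : {fset box}) : seq box := sort reading_le (enum_fset D).

Lemma reading_wordE (D : {fset box}) (T : {ffun D -> letter}) :
  reading_word T = map (ext T) (reading_seq D).
Proof.
rewrite /reading_word /reading_seq enum_fsetE [in RHS]sort_map -[RHS]map_comp.
by apply: eq_map => x /=; rewrite ext_val.
Qed.

Lemma mem_reading_seq (D : {fset box}) : reading_seq D =i D.
Proof. by move=> p; rewrite mem_sort. Qed.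

Lemma reading_seq_pairwise (D : {fset box}) : pairwise reading_lt (reading_seq D).
Proof.
pose neq := fun x y : box => x != y.
rewrite -[pairwise _ _]/(pairwise (SimplRel (fun x y => reading_le x y && neq x y)) _).
rewrite pairwise_relI -sorted_pairwise; last exact: reading_le_trans.
rewrite (sort_sorted reading_le_total) //=.
have : uniq (reading_seq D) by rewrite sort_uniq fset_uniq.
by rewrite uniq_pairwise.
Qed.

Lemma card_fset_sep (D : {fset box}) (P : pred box) :
  #|` [fset q in D | P q]| = count P (reading_seq D).
Proof.
rewrite -size_filter; apply: perm_size; apply: uniq_perm; first exact: fset_uniq.
  by rewrite filter_uniq // sort_uniq fset_uniq.
by move=> q; rewrite mem_filter mem_reading_seq !inE andbC.
Qed.

Section Split.
Variables (D : {fset box}) (p : nat).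
Hypothesis hp : p < size (reading_seq D).
Let s := reading_seq D.
Let x := nth (0%R, 0%R) s p.

Let sE : s = take p s ++ x :: drop p.+1 s.
Proof. by rewrite -drop_nth // cat_take_drop. Qed.

Let pw : [/\ all (reading_lt^~ x) (take p s) & all (reading_lt x) (drop p.+1 s)].
Proof.
have := reading_seq_pairwise D; rewrite -/s [X in pairwise _ X]sE pairwise_cat /=.
by rewrite allrel_consr => /and3P[/andP[-> _] _ /andP[-> _]].
Qed.

(** Positions in the word are traded for the reading order on boxes: unlike positions, this order is
    unaffected when boxes are removed from D. *)
Lemma count_drop_reading (a : pred box) :
  count a (drop p.+1 s) = #|` [fset q in D | reading_lt x q && a q]|.
Proof.
rewrite card_fset_sep -/s [X in _ = count _ X]sE count_cat /= reading_ltxx /=.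
case: pw => h1 h2; rewrite add0n [X in X + _](_ : _ = 0); last first.
  apply/eqP; rewrite -leqn0 leqNgt -has_count; apply/hasPn => q /(allP h1).
  by rewrite !reading_ltE; case: (a q); lia.
by rewrite add0n; apply: eq_in_count => q /(allP h2) /= ->.
Qed.

Lemma count_take_reading (a : pred box) :
  count a (take p s) = #|` [fset q in D | reading_lt q x && a q]|.
Proof.
rewrite card_fset_sep -/s [X in _ = count _ X]sE count_cat /= reading_ltxx /=.
case: pw => h1 h2; rewrite add0n [X in _ = _ + X](_ : _ = 0); last first.
  apply/eqP; rewrite -leqn0 leqNgt -has_count; apply/hasPn => q /(allP h2).
  by rewrite !reading_ltE; case: (a q); lia.
by rewrite addn0; apply: eq_in_count => q /(allP h1) /= ->.
Qed.

End Split.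

Definition leftmost_box (D : {fset box}) (L : box -> letter) (v : nat) : Prop :=
  forall x, x \in D -> (L x).1 = v ->
    (forall y, y \in D -> (L y).1 = v -> reading_le x y) -> L x = (v, false).

(** The first clause is condition (a), with j the number of letters after x; the second is condition
    (b), with j - n the number of letters before x. *)
Definition box_amenable (k : nat) (D : {fset box}) (L : box -> letter) : Prop :=
  [/\ forall x, x \in D -> (L x).1 = k ->
        #|` [fset q in D | reading_lt x q && (L q == (k, false))]|
          <> #|` [fset q in D | reading_lt x q && (L q == (k.-1, false))]|,
      forall x, x \in D -> L x = (k.-1, false) \/ L x = (k, true) ->
        #|` [fset q in D | L q == (k, false)]|
          + #|` [fset q in D | reading_lt q x && (L q == (k, true))]|
        <> #|` [fset q in D | L q == (k.-1, false)]|
          + #|` [fset q in D | reading_lt q x && (L q == (k.-1, true))]|,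
      leftmost_box D L k & leftmost_box D L k.-1].

Lemma leftmost_unmarkedP (D : {fset box}) (L : box -> letter) (v : nat) :
  reflect (leftmost_box D L v) (leftmost_unmarked (map L (reading_seq D)) v).
Proof.
rewrite /leftmost_unmarked filter_map.
set s := filter _ _.
have sP q : (q \in s) = ((L q).1 == v) && (q \in D).
  by rewrite mem_filter mem_reading_seq.
have : pairwise reading_lt s.
  have := subseq_pairwise (filter_subseq (preim L (fun l => l.1 == v)) (reading_seq D)).
  by apply; exact: reading_seq_pairwise.
case: s sP => [|x s] sP /=.
  by move=> _; left => x xD xv; have := sP x; rewrite xD xv eqxx.
case/andP => /allP lt _.
have /andP[/eqP xv xD] : ((L x).1 == v) && (x \in D) by rewrite -sP mem_head.
apply: (iffP eqP) => [Lx y yD yv ymin|h].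
  have yx := ymin x xD xv; suff -> : y = x by [].
  have : y \in x :: s by rewrite sP yv eqxx yD.
  rewrite inE => /orP[/eqP //|/lt].
  by rewrite reading_ltE; move: yx; rewrite /reading_le; lia.
apply: h => // y yD yv; have : y \in x :: s by rewrite sP yv eqxx yD.
rewrite inE => /orP[/eqP ->|/lt/andP[] //].
by rewrite /reading_le; lia.
Qed.

Lemma box_amenableP (k : nat) (D : {fset box}) (T : {ffun D -> letter}) :
  reflect (box_amenable k D (ext T)) (k_amenable k (reading_word T)).
Proof.
rewrite reading_wordE; set L := ext T; set s := reading_seq D.
have mst i p : p < size s -> mstat (map L s) i p =
    count (fun q => L q == (i, false)) (drop (size s - p) s).
  by move=> ps; rewrite /mstat size_map ltnW // -map_drop count_map.
have mst' i p : p < size s -> mstat (map L s) i (size s + p) =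
    count (fun q => L q == (i, false)) s
      + count (fun q => L q == (i, true)) (take p s).
  (* At p = 0 the index is n, where [mstat] still uses its first branch; both formulas give the
     number of all letters i. *)
  move=> ps; rewrite /mstat size_map; case: ifPn => h.
    have -> : p = 0 by lia.
    by rewrite take0 addn0 addn0 subnn drop0 count_map.
  by rewrite addKn -map_take !count_map.
have nthL p : p < size s -> nth (0, false) (map L s) p = L (nth (0%R, 0%R) s p).
  by move=> ps; rewrite (nth_map (0%R, 0%R)).
have rng m n p : p < n -> m <= m + p < m + n by lia.
have rev n p : p < n -> n - p.+1 < n by lia.
apply: (iffP and4P) => -[h1 h2 h3 h4]; split.
- move=> x xD xk; have /(nthP (0%R, 0%R))[p ps px] : x \in s by rewrite mem_reading_seq.
  rewrite -px -!count_drop_reading // => e.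
  (* The box at 0-based position p carries the letter w_(p+1), so condition (a) reaches it with j =
     n - p - 1. *)
  move/allP: h1 => /(_ (size s - p.+1)); rewrite mem_iota size_map subKn //.
  rewrite nthL // px !mst ?rev // subKn // e eqxx leq0n => /(_ isT).
  by rewrite -xk; case: (L x) => a [] /=; rewrite !inE eqxx ?orbT.
- move=> x xD xk; have /(nthP (0%R, 0%R))[p ps px] : x \in s by rewrite mem_reading_seq.
  rewrite -px -!count_take_reading // !card_fset_sep => e.
  move/allP: h2 => /(_ (size s + p)); rewrite mem_iota size_map rng // => /(_ isT).
  rewrite addKn nthL // px !mst' // e eqxx /= !inE.
  by case: xk => ->; rewrite eqxx ?orbT.
- exact/leftmost_unmarkedP.
- exact/leftmost_unmarkedP.
- apply/allP => j; rewrite mem_iota size_map add0n => /andP[_ js].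
  apply/implyP; rewrite !mst // => /eqP e.
  have [p pE ps] : exists2 p, size s - j = p.+1 & p < size s.
    by exists (size s - j.+1); [rewrite subnSK | rewrite rev].
  rewrite pE nthL //; apply/negP => hL; apply: (h1 (nth (0%R, 0%R) s p)).
  + by rewrite -mem_reading_seq mem_nth.
  + by move: hL; rewrite !inE => /orP[] /eqP ->.
  + by rewrite -!count_drop_reading // -pE.
- apply/allP => j; rewrite mem_iota size_map => /andP[sj js].
  have [p jE ps] : exists2 p, j = size s + p & p < size s.
    by exists (j - size s); [rewrite subnKC | rewrite ltn_subLR].
  move: jE sj js => -> _ _.
  rewrite !mst' // addKn nthL //; apply/implyP => /eqP e.
  apply/negP => hL; apply: (h2 (nth (0%R, 0%R) s p)).
  + by rewrite -mem_reading_seq mem_nth.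
  + by move: hL; rewrite !inE => /orP[] /eqP ->; [left|right].
  + by rewrite -!count_take_reading // !card_fset_sep.
- exact/leftmost_unmarkedP.
- exact/leftmost_unmarkedP.
Qed.

(** * Convexity and the automatic 2-amenability *)

(* Order-convexity is required only within the half plane above the main
   diagonal, since shifted diagrams have no boxes below it. *)
Definition shifted_convex (D : {fset box}) : Prop :=
  (forall a b : int, (a, b) \in D -> (1 <= a <= b)%R) /\
  forall a b c d e f : int, (a, b) \in D -> (e, f) \in D ->
    (a <= c <= e)%R -> (b <= d <= f)%R -> (c <= d)%R -> (c, d) \in D.

Lemma in_diagram (la : seq nat) (a b : int) :
  reflect (exists i j : nat, [/\ j < nth 0 la i, a = Posz i.+1 & b = Posz (i.+1 + j)])
    ((a, b) \in diagram la).
Proof.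
apply: (iffP idP) => [|[i [j [jla -> ->]]]].
  rewrite in_fset => /allpairsPdep[i [j [hi hj [-> ->]]]]; exists i, j; split => //.
  by move: hj; rewrite mem_iota.
rewrite in_fset; apply/allpairsPdep; exists i, j; split => //.
  by rewrite mem_iota /= ltnNge; apply/negP => /(nth_default 0) e; rewrite e in jla.
by rewrite mem_iota.
Qed.

(** Parts drop by at least one per row, so in the shifted diagram the right ends of the rows weakly
    move left going down. *)
Lemma strict_partition_nth (la : seq nat) (i j : nat) :
  strict_partition la -> i <= j -> j < size la -> nth 0 la j + (j - i) <= nth 0 la i.
Proof.
move=> /andP[/(sortedP 0) h _]; elim: j => [|j IH ij jla].
  by rewrite leqn0 => /eqP ->; rewrite addn0.
move: ij; rewrite leq_eqVlt => /orP[/eqP ->|]; first by rewrite subnn addn0.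
rewrite ltnS => ij; have := IH ij (ltnW jla); have /= := h _ jla; rewrite subSn //; lia.
Qed.

Lemma diagram_ideal (la : seq nat) (c d e f : int) :
  strict_partition la -> (e, f) \in diagram la ->
  (1 <= c <= e)%R -> (d <= f)%R -> (c <= d)%R -> (c, d) \in diagram la.
Proof.
move=> hla /in_diagram[i [j [jla -> ->]]] hc hd cd.
have [i' ci] : exists i' : nat, c = Posz i'.+1 by exists (`|c|.-1); lia.
have [j' dj] : exists j' : nat, d = Posz (i'.+1 + j') by exists (`|d - c|); lia.
have isz : i < size la.
  by rewrite ltnNge; apply/negP => /(nth_default 0) e'; rewrite e' in jla.
apply/in_diagram; exists i', j'; split => //.
have ii : i' <= i by lia.
have := strict_partition_nth hla ii isz; lia.
Qed.

(** Both diagrams are order ideals above the main diagonal. The larger box puts (c, d) into the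
    diagram of [la]; if (c, d) were in that of [mu], so would be (a, b). *)
Lemma skew_shifted_convex (la mu : seq nat) :
  strict_partition la -> strict_partition mu -> shifted_convex (skew_diagram la mu).
Proof.
move=> hla hmu.
have pos a b : (a, b) \in skew_diagram la mu -> (1 <= a <= b)%R.
  by rewrite in_fsetD => /andP[_ /in_diagram[i [j [_ -> ->]]]]; lia.
split=> // a b c d e f D1 D2 hc hd cd; have hab := pos _ _ D1.
move: D1 D2; rewrite !in_fsetD => /andP[nmu _] /andP[_ inla].
rewrite (diagram_ideal hla inla) ?andbT; try lia.
by apply: contra nmu => inmu; apply: (diagram_ideal hmu inmu); lia.
Qed.

Definition salmasian_inner (D : {fset box}) : {fset box} := D `\` salmasian_front D.

Lemma in_front (D : {fset box}) (a b : int) :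
  ((a, b) \in salmasian_front D) = ((a, b) \in D) && (((a - 1)%R, (b - 1)%R) \notin D).
Proof. by rewrite !inE. Qed.

Lemma in_inner (D : {fset box}) (a b : int) :
  ((a, b) \in salmasian_inner D) = ((a, b) \in D) && (((a - 1)%R, (b - 1)%R) \in D).
Proof. by rewrite in_fsetD in_front; case: (_ \in D); rewrite //= ?andbT ?andbF negbK. Qed.

(** The inner part is the intersection of D with its translate by (1, 1). *)
Lemma inner_shifted_convex (D : {fset box}) :
  shifted_convex D -> shifted_convex (salmasian_inner D).
Proof.
move=> [pos cv]; split=> [a b|a b c d e f]; rewrite !in_inner; first by case/andP => /pos.
move=> /andP[h1 h2] /andP[h3 h4] hc hd cd.
by rewrite (cv _ _ _ _ _ _ h1 h3) // (cv _ _ _ _ _ _ h2 h4) //; lia.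
Qed.

(* The relations between a box and a later one in its row, resp. column: the
   weak monotonicity combined with the condition on repeated letters. *)
Definition row_lt (l m : letter) : bool := (l.1 < m.1) || (l.1 == m.1) && ~~ m.2.
Definition col_lt (l m : letter) : bool := (l.1 < m.1) || (l.1 == m.1) && l.2.

Record box_tableau (D : {fset box}) (L : box -> letter) : Prop := BoxTableau {
  bt_pos : forall p, p \in D -> 0 < (L p).1;
  bt_row : forall a b c : int, (a, b) \in D -> (a, c) \in D -> (b < c)%R ->
    row_lt (L (a, b)) (L (a, c));
  bt_col : forall a b c : int, (a, c) \in D -> (b, c) \in D -> (a < b)%R ->
    col_lt (L (a, c)) (L (b, c)) }.

Lemma box_tableauP (D : {fset box}) (T : {ffun D -> letter}) :
  reflect (box_tableau D (ext T)) (is_tableau T).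
Proof.
apply: (iffP and5P).
  move=> [/forallP h1 h2 h3 h4 h5]; split.
  - by move=> p pD; have := h1 [` pD]; rewrite -ext_val.
  - move=> a b c b1 b2 bc.
    have /implyP := forallP (forallP h2 [` b1]) [` b2].
    have /implyP := forallP (forallP h5 [` b1]) [` b2].
    rewrite -!ext_val /= -val_eqE /= eqxx xpair_eqE eqxx (ltW bc) (lt_eqF bc) /=.
    rewrite /letter_le /row_lt.
    case: (ext T (a, b)) (ext T (a, c)) => [l1 l2] [m1 m2] /=; rewrite xpair_eqE.
    by case: l2 m2 => [] [] /=; case: (ltngtP l1 m1) => //= _ h; move=> /(_ isT).
  - move=> a c b b1 b2 bc.
    have /implyP := forallP (forallP h3 [` b1]) [` b2].
    have /implyP := forallP (forallP h4 [` b1]) [` b2].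
    rewrite -!ext_val /= -val_eqE /= eqxx xpair_eqE eqxx (ltW bc) (lt_eqF bc) /=.
    rewrite /letter_le /col_lt.
    case: (ext T (a, b)) (ext T (c, b)) => [l1 l2] [m1 m2] /=; rewrite xpair_eqE.
    by case: l2 m2 => [] [] /=; case: (ltngtP l1 m1) => //= _ h; move=> /(_ isT).
move=> [h1 h2 h3]; split.
- by apply/forallP => x; rewrite -ext_val h1 ?fsvalP.
- apply/forallP => -[[a b] /= x]; apply/forallP => -[[c d] /= y].
  apply/implyP => /= /andP[/eqP ac bd]; subst c.
  rewrite -!ext_val /=; move: bd; rewrite le_eqVlt => /orP[/eqP -> |/(h2 _ _ _ x y)].
    by rewrite /letter_le ltnn eqxx implybb.
  rewrite /row_lt /letter_le => /orP[->//|/andP[->]].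
  by case: (ext _ _).2 => //; rewrite orbT.
- apply/forallP => -[[a b] /= x]; apply/forallP => -[[c d] /= y].
  apply/implyP => /= /andP[/eqP ac bd]; subst d.
  rewrite -!ext_val /=; move: bd; rewrite le_eqVlt => /orP[/eqP -> |/(h3 _ _ _ x y)].
    by rewrite /letter_le ltnn eqxx implybb.
  rewrite /col_lt /letter_le => /orP[->//|/andP[-> ->]].
  by rewrite implybT orbT.
- apply/forallP => -[[a b] /= x]; apply/forallP => -[[c d] /= y].
  apply/implyP; rewrite -!ext_val -val_eqE /= => /and3P[/eqP bd e nm]; subst d.
  rewrite xpair_eqE eqxx andbT; case: (ltgtP a c) => // lt.
    by have := h3 _ _ _ x y lt; rewrite /col_lt (eqP e) ltnn eqxx -(eqP e) (negbTE nm).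
  by have := h3 _ _ _ y x lt; rewrite /col_lt (eqP e) ltnn eqxx -(eqP e) (negbTE nm).
- apply/forallP => -[[a b] /= x]; apply/forallP => -[[c d] /= y].
  apply/implyP; rewrite -!ext_val -val_eqE /= => /and3P[/eqP ac e nm]; subst c.
  rewrite xpair_eqE eqxx; case: (ltgtP b d) => // lt.
    by have := h2 _ _ _ x y lt; rewrite /row_lt (eqP e) ltnn eqxx -(eqP e) nm.
  by have := h2 _ _ _ y x lt; rewrite /row_lt (eqP e) ltnn eqxx -(eqP e) nm.
Qed.

(** The box (a, b + 1) lies in D by convexity. If its letter is marked, the row step into it is
    strict in value; if unmarked, the column step out of it is. *)
Lemma tableau_diag_lt (D : {fset box}) (L : box -> letter) (a b : int) :
  shifted_convex D -> box_tableau D L ->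
  (a, b) \in D -> ((a + 1)%R, (b + 1)%R) \in D ->
  (L (a, b)).1 < (L ((a + 1)%R, (b + 1)%R)).1.
Proof.
move=> [pos cv] [_ row col] h1 h2; have := pos _ _ h1 => hp.
have h3 : (a, (b + 1)%R) \in D by apply: (cv _ _ _ _ _ _ h1 h2); lia.
have lt1 (x : int) : (x < x + 1)%R by lia.
have := row _ _ _ h1 h3 (lt1 _); have := col _ _ _ h3 h2 (lt1 _); rewrite /row_lt /col_lt.
case: (L (a, (b + 1)%R)) => m [] /=; rewrite ?andbT ?andbF ?orbF.
  by move=> /orP[mlt lt|/eqP <- //]; exact: ltn_trans lt mlt.
by move=> mlt /orP[lt|/eqP -> //]; exact: ltn_trans lt mlt.
Qed.

(** Compares A and B through their images in a common target, which avoids choosing an injection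
    from A to B. *)
Lemma leq_card_fibre (K T : choiceType) (f g : K -> T) (A B : {fset K}) :
  {in A &, injective f} ->
  (forall p, p \in A -> exists2 q, q \in B & g q = f p) -> #|` A| <= #|` B|.
Proof.
move=> inj h.
have e : #|` [fset f x | x in A]| = #|` A| by exact: card_in_imfset.
have e' : #|` [fset g x | x in B]| <= #|` B| by exact: leq_imfset_card.
rewrite -e; apply: leq_trans e'; rewrite fsubset_leq_card //.
apply/fsubsetP => _ /imfsetP[p /= pA ->]; have [q qB <-] := h p pA.
by apply/imfsetP; exists q.
Qed.

Section TwoAmenable.
Variables (D : {fset box}) (L : box -> letter).
Hypotheses (cvD : shifted_convex D) (tabL : box_tableau D L).
Hypothesis front1 : forall p, p \in salmasian_front D -> (L p).1 = 1.

Lemma tableau_two_above (a b : int) : (a, b) \in D -> (L (a, b)).1 = 2 ->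
  [/\ ((a - 1)%R, (b - 1)%R) \in D, (L ((a - 1)%R, (b - 1)%R)).1 = 1 &
      ((a - 1)%R, b) \in D].
Proof.
move=> abD L2; have [pos cv] := cvD.
have pD : ((a - 1)%R, (b - 1)%R) \in D.
  apply/negPn/negP => nD; have := @front1 (a, b); rewrite in_front abD nD L2.
  by move/(_ isT).
have hp := pos _ _ pD; split=> //; last by apply: (cv _ _ _ _ _ _ pD abD); lia.
have := tableau_diag_lt cvD tabL pD; rewrite !subrK L2 => /(_ abD) lt2.
by apply/eqP; rewrite eqn_leq -ltnS lt2 (bt_pos tabL pD).
Qed.

(** Going up the column from a 2 or 2', the next box is again in D and has value 1 or 2. When the
    value 1 is reached it is unmarked, because its left neighbour also has value 1. *)
Lemma tableau_two_column (a b : int) : (a, b) \in D -> (L (a, b)).1 = 2 ->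
  exists c : int, [/\ (c < a)%R, (c, b) \in D & L (c, b) = (1, false)].
Proof.
(* Rows are numbered from 1, so induction on a bound for the row ends the climb. *)
have [n] : exists n : nat, (a <= Posz n)%R by exists (`|a|); lia.
elim: n a => [|n IH] a an abD L2; have [pos cv] := cvD.
  by have := pos _ _ abD; lia.
have [d1 d2 d3] := tableau_two_above abD L2.
have lt1 (x : int) : (x - 1 < x)%R by lia.
have := bt_row tabL d1 d3 (lt1 _); have := bt_col tabL d3 abD (lt1 _).
rewrite /row_lt /col_lt L2 d2 => cl rw.
have [e|ne] := eqVneq (L ((a - 1)%R, b)).1 2.
  have [|c [ca cD cL]] := IH (a - 1)%R _ d3 e; first by lia.
  by exists c; split=> //; apply: lt_trans ca (lt1 a).
exists (a - 1)%R; split=> //.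
move: rw cl ne; case: (L ((a - 1)%R, b)) => -[|[|[|l]]] [] //=.
Qed.

Let shift (p : box) : box := ((p.1 + 1)%R, (p.2 + 1)%R).

Let one_above r := [fset q in D | (q.1 < r)%R && (L q == (1, false))].
Let two_upto r := [fset q in D | (q.1 == r) && ((L q).1 == 2)
                                 || (q.1 < r)%R && (L q == (2, false))].
Let two_below r := [fset q in D | (r < q.1)%R && ((L q).1 == 2)].
Let one_from r := [fset q in D | (r <= q.1)%R && ((L q).1 == 1)].

(** The column is the common target. Of two boxes of [two_upto r] in one column, the upper would be
    an unmarked 2 above a letter of value 2, which a tableau forbids. *)
Lemma card_two_upto (r : int) : #|` two_upto r| <= #|` one_above r|.
Proof.
apply: (leq_card_fibre (f := snd) (g := snd)) => [[a b] [c d]|[a b]].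
  rewrite !inE /= => /andP[pD hp] /andP[qD hq] e; subst d; congr (_, _).
  have L2 u : (u == r) && ((L (u, b)).1 == 2) || (u < r)%R && (L (u, b) == (2, false)) ->
      (u <= r)%R /\ (L (u, b)).1 = 2.
    by case/orP => /andP[ur /eqP ->]; split=> //; [rewrite (eqP ur)|apply: ltW].
  have [ar a2] := L2 _ hp; have [cr c2] := L2 _ hq.
  have no u v : (u, b) \in D -> (v, b) \in D -> (u < v)%R -> (v <= r)%R ->
      (u == r) && ((L (u, b)).1 == 2) || (u < r)%R && (L (u, b) == (2, false)) ->
      (L (v, b)).1 = 2 -> False.
    move=> uD vD uv vr hu v2; have ur := lt_le_trans uv vr.
    move: hu; rewrite (lt_eqF ur) ur /= => /eqP u2.
    by have := bt_col tabL uD vD uv; rewrite /col_lt u2 v2.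
  case: (ltgtP a c) => // lt; exfalso.
    exact: no pD qD lt cr hp c2.
  exact: no qD pD lt ar hq a2.
rewrite !inE /= => /andP[pD hp].
have L2 : (L (a, b)).1 = 2 by case/orP: hp => /andP[_ /eqP ->].
have ar : (a <= r)%R by case/orP: hp => /andP[]; [move/eqP ->|move/ltW].
have [c [ca cD cL]] := tableau_two_column pD L2.
by exists (c, b) => //; rewrite !inE /= cD cL eqxx andbT (lt_le_trans ca ar).
Qed.

Lemma two_below_shift (r : int) (p : box) : p \in two_below r ->
  exists2 q, q \in one_from r & shift q = p.
Proof.
case: p => a b; rewrite !inE /= => /and3P[pD ra /eqP L2].
have [d1 d2 _] := tableau_two_above pD L2.
exists ((a - 1)%R, (b - 1)%R); last by rewrite /shift /= !subrK.
by rewrite !inE /= d1 d2 eqxx andbT; lia.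
Qed.

(** Strictness comes from x itself, which lies in [two_upto] for its row but is not counted on the
    left. The 1s strictly above the row of x are all read after x. *)
Lemma two_amenable_unmarked (x : box) : x \in D -> (L x).1 = 2 ->
  #|` [fset q in D | reading_lt x q && (L q == (2, false))]|
    < #|` [fset q in D | reading_lt x q && (L q == (1, false))]|.
Proof.
move=> xD x2; set A := [fset q in D | _].
have sub : x |` A `<=` two_upto x.1.
  apply/fsubsetP => q; rewrite !inE /= => /orP[/eqP ->|/and3P[qD]].
    by rewrite xD x2 !eqxx.
  rewrite reading_ltE qD /= => /orP[-> ->|/andP[/eqP -> _] /eqP ->].
    by rewrite orbT.
  by rewrite !eqxx.
have xA : x \notin A by rewrite !inE /= reading_ltxx !andbF.
have := fsubset_leq_card sub; rewrite cardfsU1 xA add1n => lt.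
apply: leq_trans lt _; apply: leq_trans (card_two_upto x.1) _.
apply/fsubset_leq_card/fsubsetP => q; rewrite !inE /= => /and3P[-> lt ->].
by rewrite reading_ltE lt.
Qed.

(* The letters 2, 2' below row r go diagonally to letters 1, 1' in rows >= r, the
   remaining ones that are counted go to unmarked 1s above row r in their columns.
   Strictness comes from a 2' in row r, which is not counted, or else from the
   last 1 or 1' in row r, which the diagonal map misses. *)
Lemma two_amenable_marked (x : box) : x \in D -> L x = (1, false) \/ L x = (2, true) ->
  #|` [fset q in D | L q == (2, false)]|
    + #|` [fset q in D | reading_lt q x && (L q == (2, true))]|
  < #|` [fset q in D | L q == (1, false)]|
    + #|` [fset q in D | reading_lt q x && (L q == (1, true))]|.
Proof.
case: x => r c xD hx.
set C2 := [fset q in D | _]; set C2' := [fset q in D | _].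
set C1 := [fset q in D | _]; set C1' := [fset q in D | _].
have cardC2 : #|` C2 `|` C2'| = #|` C2| + #|` C2'|.
  rewrite -cardfsUI (_ : C2 `&` C2' = fset0) ?cardfs0 ?addn0 //.
  apply/fsetP => q; rewrite !inE; case: (L q) => l [] /=; rewrite !xpair_eqE ?andbF //.
have cardW : #|` one_from r `|` one_above r| = #|` one_from r| + #|` one_above r|.
  rewrite -cardfsUI (_ : one_from r `&` one_above r = fset0) ?cardfs0 ?addn0 //.
  apply/fsetP => q; rewrite !inE; case: (ltrP q.1 r); rewrite ?andbF ?andFb //.
have subC2 : C2 `|` C2' `<=` two_below r `|` two_upto r.
  apply/fsubsetP => q; rewrite !inE /=.
  case/orP => /andP[qD]; rewrite qD /=.
    by move/eqP => L2; rewrite L2 /= ?eqxx ?andbT; case: (ltrgtP q.1 r).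
  case/andP; rewrite reading_ltE /= => h /eqP ->; rewrite /= !andbT.
  by case/orP: h => [->//|/andP[-> _]]; rewrite orbT.
have subW : one_from r `|` one_above r `<=` C1 `|` C1'.
  apply/fsubsetP => -[a b]; rewrite !inE /=.
  case/orP => /and3P[qD]; rewrite qD /=; last by move=> _ ->.
  move=> ra; case Lq : (L (a, b)) => [l []] /= /eqP l1; subst l; last by rewrite eqxx.
  (* What remains is a 1' in row r or below. In row r it stands to the left of x, since no 1 or 2'
     can precede a 1' in its row. *)
  rewrite andbT orFb reading_ltE /=; move: ra; rewrite le_eqVlt => /orP[/eqP ra|->//]; subst a.
  rewrite eqxx ltxx /=; case: (ltgtP b c) => // [cb|cb].
    have := bt_row tabL xD qD cb; rewrite /row_lt Lq.
    by case: hx => ->.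
  by move: Lq; rewrite cb; case: hx => ->.
have le2 : #|` two_below r `|` two_upto r| <= #|` two_below r| + #|` two_upto r|.
  by rewrite -cardfsUI leq_addr.
have le1 : #|` one_from r| + #|` one_above r| <= #|` C1| + #|` C1'|.
  by rewrite -cardW -[leqRHS]cardfsUI (leq_trans (fsubset_leq_card subW)) // leq_addr.
have upto := card_two_upto r.
have below : #|` two_below r| <= #|` one_from r|.
  exact: (leq_card_fibre (f := id) (g := shift) _ (two_below_shift (r := r))).
rewrite -cardC2; apply: leq_trans le1.
(* A 2' in row r is in [two_upto r] but is not counted: no 1 and no further 2' can stand to its
   right, so it does not precede x. *)
have [/existsP[[[a b] /= yD] /andP[/eqP ar /eqP Ly]]|no] :=
  boolP [exists y : D, ((val y).1 == r) && (L (val y) == (2, true))].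
  subst a; have yC : (r, b) \notin C2 `|` C2'.
    rewrite !inE /= yD Ly /= andbT reading_ltE /= eqxx ltxx /= -leNgt.
    case: (ltgtP c b) => // bc; have := bt_row tabL yD xD bc; rewrite /row_lt Ly.
    by case: hx => ->.
  have : (r, b) |` (C2 `|` C2') `<=` two_below r `|` two_upto r.
    by rewrite fsubUset subC2 andbT fsub1set !inE /= yD Ly !eqxx orbT.
  move/fsubset_leq_card; rewrite cardfsU1 yC add1n => lt.
  by apply: leq_trans lt _; apply: leq_trans le2 _; exact: leq_add.
have no2 a b : (a, b) \in D -> a = r -> L (a, b) <> (2, true).
  by move=> abD ar Lab; case/existsP: no; exists [` abD]; rewrite /= Lab ar !eqxx.
have {hx}Lx : L (r, c) = (1, false) by case: hx => // /no2 []//.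
suff lt_below : #|` two_below r| < #|` one_from r|.
  apply: leq_ltn_trans (fsubset_leq_card subC2) _; apply: leq_ltn_trans le2 _.
  by rewrite -addSn; apply: leq_add lt_below upto.
(* Now x is an unmarked 1, so row r contains the value 1. Its rightmost such box is shown to be
   missed by the diagonal map. *)
pose P (y : D) := ((val y).1 == r) && ((L (val y)).1 == 1).
have Px : P [` xD] by rewrite /P /= Lx !eqxx.
case: (arg_maxP (fun y : D => (val y).2) Px) => -[[a b] /= zD] /andP[/= /eqP ar /eqP z1] zmax.
subst a; have zW : (r, b) \in one_from r by rewrite !inE /= zD lexx z1.
rewrite [X in _ < X](cardfsD1 (r, b)) zW add1n ltnS.
apply: (leq_card_fibre (f := id) (g := shift)) => // p pX.
have [q qW qp] := two_below_shift pX; exists q => //.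
rewrite in_fsetD1 qW andbT; apply/eqP => qz; subst q.
move: pX; rewrite -qp !inE /= => /and3P[pD _ /eqP p2].
have [pos cv] := cvD; have hz := pos _ _ zD.
have lt1 (u : int) : (u < u + 1)%R by rewrite ltrDl.
have /andP[_ rb] := hz.
have sD : (r, (b + 1)%R) \in D.
  apply: (cv _ _ _ _ _ _ zD pD); rewrite ?lexx ?andbT ?(ltW (lt1 _)) //.
  exact: ltW (le_lt_trans rb (lt1 b)).
(* The right neighbour of this box stands directly above a letter of value 2, so it has value 1,
   against the choice of the rightmost box, or is a 2' in row r. *)
have := bt_row tabL zD sD (lt1 _); have := bt_col tabL sD pD (lt1 _).
rewrite /row_lt /col_lt z1 p2.
case Ls : (L (r, (b + 1)%R)) => [[|[|[|l]]] [] ] //= _ _; last exact: no2 sD erefl Ls.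
have := zmax [` sD]; rewrite /P /= eqxx Ls /= => /(_ isT).
by have := lt1 b; rewrite ltNge => /negP.
Qed.

Lemma box_amenable_two :
  leftmost_box D L 2 -> leftmost_box D L 1 -> box_amenable 2 D L.
Proof.
move=> lm2 lm1; split=> // x xD hx e.
  by have := two_amenable_unmarked xD hx; rewrite e ltnn.
by have := two_amenable_marked xD hx; rewrite e ltnn.
Qed.

End TwoAmenable.

(** * Components of the front *)

(* The only boxes of the front whose mark is not forced by their neighbours. *)
Definition front_ends (D : {fset box}) : {fset box} :=
  [fset p in salmasian_front D | (((p.1 + 1)%R, p.2) \notin salmasian_front D)
                                 && ((p.1, (p.2 - 1)%R) \notin salmasian_front D)].

Lemma in_fset_sep (K : choiceType) (A : {fset K}) (Q : pred K) (p : K) :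
  (p \in [fset q in A | Q q]) = (p \in A) && Q p.
Proof. by rewrite !inE. Qed.

Lemma in_front_ends (D : {fset box}) (p : box) :
  (p \in front_ends D) = [&& p \in salmasian_front D,
    ((p.1 + 1)%R, p.2) \notin salmasian_front D
    & (p.1, (p.2 - 1)%R) \notin salmasian_front D].
Proof. exact: in_fset_sep. Qed.

(** The second box is the diagonal predecessor of the first. Hence a front box never has both its
    lower and its left neighbour in the front. *)
Lemma front_down_left (D : {fset box}) (a b : int) :
  ((a + 1)%R, b) \in salmasian_front D -> (a, (b - 1)%R) \notin salmasian_front D.
Proof. by rewrite !in_front addrK => /andP[_ /negbTE ->]. Qed.

Section Components.
Variable D : {fset box}.
Let P := salmasian_front D.
Let e (x y : P) := edge_adjacent (val x) (val y).

(** Each component of the front is a path; [next] walks it one box towards its lower left end and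
    stays there. *)
Let next (x : P) : P :=
  if insub ((val x).1 + 1, (val x).2)%R is Some y then y
  else if insub ((val x).1, (val x).2 - 1)%R is Some y then y else x.

Let nextP (x : P) : [\/ val (next x) = ((val x).1 + 1, (val x).2)%R,
  val (next x) = ((val x).1, (val x).2 - 1)%R | next x = x /\ val x \in front_ends D].
Proof.
rewrite /next; case: insubP => [y _ ->|n1]; first by constructor 1.
case: insubP => [y _ ->|n2]; first by constructor 2.
by constructor 3; rewrite in_front_ends fsvalP n1 n2.
Qed.

Let next_end (x : P) : val x \in front_ends D -> next x = x.
Proof.
rewrite in_front_ends => /and3P[_ n1 n2].
by rewrite /next !insubN.
Qed.

Let next_adj (x : P) : next x = x \/ e x (next x).
Proof.
case: (nextP x) => [h|h|[h _]]; [right|right|by left]; rewrite /e h /edge_adjacent /=; lia.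
Qed.

Let adj_next (x y : P) : e x y -> next x = y \/ next y = x.
Proof.
move: x y => [[a b] xP] [[c d] yP]; rewrite /e /edge_adjacent /= => h.
have down u v (h1 : (u, v) \in P) (h2 : ((u + 1)%R, v) \in P) : next [` h1] = [` h2].
  by rewrite /next /= insubT; apply: val_inj.
have left u v (h1 : (u, v) \in P) (h2 : (u, (v - 1)%R) \in P) : next [` h1] = [` h2].
  rewrite /next /= insubN ?insubT; first by apply: val_inj.
  by apply/negP => /front_down_left; rewrite h2.
have : [\/ c = (a + 1)%R /\ d = b, a = (c + 1)%R /\ b = d, c = a /\ d = (b - 1)%R
         | a = c /\ b = (d - 1)%R].
  have [h1|[h1|[h1|h1]]] : (c = (a + 1)%R /\ d = b) \/ (a = (c + 1)%R /\ b = d)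
     \/ (c = a /\ d = (b - 1)%R) \/ (a = c /\ b = (d - 1)%R) by lia.
  - by constructor 1.
  - by constructor 2.
  - by constructor 3.
  - by constructor 4.
by case=> -[? ?]; subst; [left; exact: down | right; exact: down
  | left; exact: left | right; exact: left].
Qed.

(** Termination measure: [next] lowers column minus row, so at most as many steps as there are front
    boxes lead to the end. *)
Let height (x : P) := #|[pred y : P | ((val y).2 - (val y).1 < (val x).2 - (val x).1)%R]|.

Let next_height (x : P) : next x != x -> height (next x) < height x.
Proof.
move=> nx; have lt : ((val (next x)).2 - (val (next x)).1 < (val x).2 - (val x).1)%R.
  case: (nextP x) => [->|->|[h _]] /=; [lia|lia|by rewrite h eqxx in nx].
apply: proper_card; apply/properP; split.
  by apply/subsetP => y; rewrite !inE => h; apply: lt_trans h lt.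
by exists (next x); rewrite !inE ?ltxx.
Qed.

Let to_end (x : P) := iter #|{: P}| next x.

Let to_end_fix (x : P) : next (to_end x) = to_end x.
Proof.
rewrite /to_end; have : height x <= #|{: P}| by exact: max_card.
elim: #|_| x => [|n IH] x hx; have [fx|nx] := eqVneq (next x) x.
- by rewrite /= fx.
- by have := leq_trans (next_height nx) hx.
- by rewrite (_ : iter _ _ x = x) // iter_fix.
- by rewrite iterSr IH // -ltnS; apply: leq_trans (next_height nx) hx.
Qed.

Let to_end_next (x : P) : to_end (next x) = to_end x.
Proof. by rewrite /to_end -iterSr iterS to_end_fix. Qed.

Let connect_to_end (x : P) : connect e x (to_end x).
Proof.
rewrite /to_end; elim: #|_| => [|n IH] /=; first exact: connect0.
apply: connect_trans IH _; case: (next_adj (iter n next x)) => [->|/connect1 //].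
exact: connect0.
Qed.

Let connect_same_end (x y : P) : connect e x y -> to_end x = to_end y.
Proof.
case/connectP => p; elim: p x => [|z p IH] x /=; first by move=> _ ->.
case/andP => /adj_next xz pz yl; rewrite -(IH z pz yl).
by case: xz => <-; rewrite to_end_next.
Qed.

(** Adjacent boxes are consecutive under [next] and so share their end, and every box is connected
    to its end. Hence [to_end] matches component roots with ends bijectively. *)
Lemma num_components_front : num_components (salmasian_front D) = #|` front_ends D|.
Proof.
have symE : connect_sym e.
  apply: sym_connect_sym => x y; rewrite /e /edge_adjacent.
  by lia.
have cardR : #|to_end @: [set x | roots e x]| = #|[set x | roots e x]|.
  apply: card_in_imset => x y; rewrite !inE => /eqP rx /eqP ry xy.
  rewrite -rx -ry; apply/(fingraph.rootP symE).
  by rewrite (connect_trans (connect_to_end x)) // xy symE connect_to_end.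
have imR : to_end @: [set x | roots e x] = [set x | val x \in front_ends D].
  apply/setP => y; rewrite inE; apply/imsetP/idP => [[x _ ->]|yend].
    by have [h|h|[_ //]] := nextP (to_end x); move: h; rewrite to_end_fix => h;
       exfalso; have := congr1 fst h; have := congr1 snd h => /=; lia.
  exists (fingraph.root e y); first by rewrite inE (roots_root symE).
  rewrite -(connect_same_end (connect_root e y)).
  by rewrite /to_end iter_fix // next_end.
rewrite /num_components /n_comp_mem.
transitivity #|[set x | roots e x]|.
  by apply: eq_card => x; rewrite !inE andbT.
rewrite -cardR imR -[RHS](@card_fsub _ P) //.
by apply/fsubsetP => p; rewrite in_front_ends => /andP[].
Qed.

End Components.

(** * Peeling off the front *)

(** The diagonal predecessor of (a, c) lies between (a - 1, b - 1) and (a, c), hence in D. So in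
    each row the front comes before the inner part. *)
Lemma inner_row (D : {fset box}) (a b c : int) : shifted_convex D ->
  (a, b) \in salmasian_inner D -> (a, c) \in D -> (b < c)%R ->
  (a, c) \in salmasian_inner D.
Proof.
move=> [pos cv]; rewrite !in_inner => /andP[h1 h2] h3 bc; rewrite h3 /=.
by have := pos _ _ h1; move=> ab; apply: (cv _ _ _ _ _ _ h2 h3); lia.
Qed.

Lemma inner_col (D : {fset box}) (a b c : int) : shifted_convex D ->
  (a, c) \in salmasian_inner D -> (b, c) \in D -> (a < b)%R ->
  (b, c) \in salmasian_inner D.
Proof.
move=> [pos cv]; rewrite !in_inner => /andP[h1 h2] h3 bc; rewrite h3 /=.
by have := pos _ _ h3; move=> ab; apply: (cv _ _ _ _ _ _ h2 h3); lia.
Qed.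

Lemma front_sub (D : {fset box}) : salmasian_front D `<=` D.
Proof. by apply/fsubsetP => -[a b]; rewrite in_front => /andP[]. Qed.

Lemma inner_sub (D : {fset box}) : salmasian_inner D `<=` D.
Proof. exact: fsubsetDl. Qed.

Lemma front_inner (D : {fset box}) (p : box) : p \in D ->
  (p \in salmasian_front D) = (p \notin salmasian_inner D).
Proof. by case: p => a b pD; rewrite in_front in_inner pD. Qed.

(** The marks of L on the front are left open; [front_marked] constrains them separately. *)
Definition peels (D : {fset box}) (L L' : box -> letter) : Prop :=
  (forall p, p \in salmasian_inner D -> L p = ((L' p).1.+1, (L' p).2)) /\
  (forall p, p \in salmasian_front D -> (L p).1 = 1).

Section Peel.
Variables (D : {fset box}) (L L' : box -> letter).
Hypothesis hp : peels D L L'.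
Let U := salmasian_inner D.
Let P := salmasian_front D.

Lemma peels_value (v : nat) (p : box) : p \in D ->
  ((L p).1 == v.+2) = (p \in U) && ((L' p).1 == v.+1).
Proof.
move=> pD; case: (boolP (p \in U)) => [pU|pU]; first by rewrite hp.1.
by rewrite hp.2 // front_inner.
Qed.

Lemma peels_letter (v : nat) (b : bool) (p : box) : p \in D ->
  (L p == (v.+2, b)) = (p \in U) && (L' p == (v.+1, b)).
Proof.
move=> pD; case: (boolP (p \in U)) => [pU|pU].
  by rewrite hp.1 //; case: (L' p) => x y; rewrite !xpair_eqE.
have := hp.2 p; rewrite front_inner // pU => /(_ isT).
by case: (L p) => x y /= ->; rewrite xpair_eqE.
Qed.

Lemma peels_sep (Q : pred box) (v : nat) (b : bool) :
  [fset q in D | Q q && (L q == (v.+2, b))] = [fset q in U | Q q && (L' q == (v.+1, b))].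
Proof.
apply/fsetP => q; rewrite !in_fset_sep; case: (boolP (q \in D)) => [qD|qD].
  by rewrite peels_letter //; case: (Q q); rewrite ?andbF.
by rewrite (negbTE (contra (fsubsetP (inner_sub D) q) qD)).
Qed.

Lemma peels_sepT (v : nat) (b : bool) :
  [fset q in D | L q == (v.+2, b)] = [fset q in U | L' q == (v.+1, b)].
Proof. exact: (peels_sep xpredT). Qed.

Lemma peels_sep_value (v : nat) :
  [fset q in D | (L q).1 == v.+2] = [fset q in U | (L' q).1 == v.+1].
Proof.
apply/fsetP => q; rewrite !in_fset_sep; case: (boolP (q \in D)) => [qD|qD].
  by rewrite peels_value //.
by rewrite (negbTE (contra (fsubsetP (inner_sub D) q) qD)).
Qed.

Lemma peels_leftmost (v : nat) : leftmost_box D L v.+2 <-> leftmost_box U L' v.+1.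
Proof.
have UD q : q \in U -> q \in D by exact: (fsubsetP (inner_sub D)).
split=> h x xD xv hx.
  have /eqP : L x = (v.+2, false).
    apply: h; [exact: UD|by rewrite hp.1 // xv|].
    move=> y yD /eqP; rewrite peels_value // => /andP[yU /eqP yv]; exact: hx.
  by rewrite peels_letter ?UD // => /andP[_ /eqP].
move/eqP: xv; rewrite peels_value // => /andP[xU /eqP xv].
rewrite hp.1 // (h x) // => y yU yv; apply: hx; first exact: UD.
by rewrite hp.1 // yv.
Qed.

(** For k at least 3 both k and k - 1 exceed 1, so all boxes that the conditions mention lie in the
    inner part, which inherits the reading order. *)
Lemma peels_amenable (v : nat) : box_amenable v.+3 D L <-> box_amenable v.+2 U L'.
Proof.
have UD q : q \in U -> q \in D by exact: (fsubsetP (inner_sub D)).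
split=> -[h1 h2 h3 h4]; split; try by apply/peels_leftmost.
- move=> x xU xv; rewrite -!peels_sep; apply: h1; first exact: UD.
  by rewrite hp.1 // xv.
- move=> x xU xv; rewrite -!peels_sep -!peels_sepT; apply: h2; first exact: UD.
  by rewrite hp.1 //; case: xv => ->; [left|right].
- move=> x xD /eqP; rewrite peels_value // => /andP[xU /eqP xv].
  by rewrite /= !peels_sep; apply: h1.
- move=> x xD xv; rewrite /= !peels_sep !peels_sepT; apply: h2.
    by case: xv => /eqP; rewrite peels_letter // => /andP[].
  by case: xv => /eqP; rewrite peels_letter // => /andP[_ /eqP ->]; [left|right].
Qed.

Hypothesis cvD : shifted_convex D.

Lemma peels_tableau : box_tableau D L -> box_tableau U L'.
Proof.
have UD q : q \in U -> q \in D by exact: (fsubsetP (inner_sub D)).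
move=> tabL; split.
- move=> [a b] pU; move: (pU); rewrite in_inner => /andP[pD qD].
  (* The value in an inner box exceeds the positive value of its diagonal predecessor, so it stays
     positive when lowered by one. *)
  have := tableau_diag_lt cvD tabL qD; rewrite !subrK (hp.1 _ pU) => /(_ pD).
  rewrite /= ltnS; exact: leq_trans (bt_pos tabL qD).
- move=> a b c h1 h2 bc; have := bt_row tabL (UD _ h1) (UD _ h2) bc.
  by rewrite /row_lt !hp.1.
- move=> a b c h1 h2 bc; have := bt_col tabL (UD _ h1) (UD _ h2) bc.
  by rewrite /col_lt !hp.1.
Qed.

(** This is what [col_lt] and [row_lt] require of neighbouring front boxes once both have value
    1. *)
Definition front_marked : Prop :=
  forall a b : int, (a, b) \in P ->
    ((((a + 1)%R, b) \in P) -> (L (a, b)).2) /\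
    (((a, (b - 1)%R) \in P) -> ~~ (L (a, b)).2).

Lemma tableau_front_marked : box_tableau D L -> front_marked.
Proof.
have PD q : q \in P -> q \in D by exact: (fsubsetP (front_sub D)).
move=> tabL a b pP; split=> qP.
  have := bt_col tabL (PD _ pP) (PD _ qP); rewrite /col_lt !hp.2 //=.
  by apply; rewrite ltrDl.
have := bt_row tabL (PD _ qP) (PD _ pP); rewrite /row_lt !hp.2 //=.
by apply; rewrite ltrBlDr ltrDl.
Qed.

(** Front boxes precede inner ones in every row and column and have the smaller value. Between two
    front boxes of a row or column all boxes are in the front, so the condition on neighbours
    suffices. *)
Lemma unpeel_tableau : front_marked -> box_tableau U L' -> box_tableau D L.
Proof.
move=> hm tabL'; have [pos cv] := cvD.
have valU p : p \in U -> 1 < (L p).1.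
  by move=> pU; rewrite hp.1 //= ltnS (bt_pos tabL' pU).
split.
- move=> p pD; case: (boolP (p \in U)) => [/valU/ltnW //|pU].
  by rewrite hp.2 // front_inner.
- move=> a b c h1 h2 bc.
  case: (boolP ((a, b) \in U)) => [bU|bU].
    have cU := inner_row cvD bU h2 bc.
    by have := bt_row tabL' bU cU bc; rewrite /row_lt !hp.1.
  have b1 : (L (a, b)).1 = 1 by rewrite hp.2 // front_inner.
  case: (boolP ((a, c) \in U)) => [cU|cU]; first by rewrite /row_lt b1 valU.
  have cP : (a, c) \in P by rewrite front_inner.
  have lt1 : (c - 1 < c)%R by rewrite ltrBlDr ltrDl.
  have pab := pos _ _ h1.
  have c1D : (a, (c - 1)%R) \in D by apply: (cv _ _ _ _ _ _ h1 h2); lia.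
  have c1P : (a, (c - 1)%R) \in P.
    by rewrite front_inner //; apply: contra cU => u; exact: (inner_row cvD u h2 lt1).
  by rewrite /row_lt b1 hp.2 //= (hm a c cP).2.
- move=> a b c h1 h2 ab.
  case: (boolP ((a, c) \in U)) => [aU|aU].
    have bU := inner_col cvD aU h2 ab.
    by have := bt_col tabL' aU bU ab; rewrite /col_lt !hp.1.
  have aP : (a, c) \in P by rewrite front_inner.
  have a1 : (L (a, c)).1 = 1 by rewrite hp.2.
  case: (boolP ((b, c) \in U)) => [bU|bU]; first by rewrite /col_lt a1 valU.
  have bP : (b, c) \in P by rewrite front_inner.
  have pbc := pos _ _ h2.
  have a1D : ((a + 1)%R, c) \in D by apply: (cv _ _ _ _ _ _ h1 h2); lia.
  have a1P : ((a + 1)%R, c) \in P.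
    rewrite front_inner //; apply: contra bU => u.
    have : (a + 1 <= b)%R by lia.
    rewrite le_eqVlt => /orP[/eqP <- //|lt]; exact: (inner_col cvD u h2 lt).
  by rewrite /col_lt a1 hp.2 //= (hm a c aP).1 // orbT.
Qed.

End Peel.

(** * Counting fillings across one peeling step *)

Lemma card_sep (D : {fset box}) (Q : pred box) :
  #|[pred x : D | Q (val x)]| = #|` [fset q in D | Q q]|.
Proof.
rewrite -(@card_fsub _ D); last by apply/fsubsetP => q; rewrite in_fset_sep => /andP[].
by apply: eq_card => x; rewrite !inE fsvalP.
Qed.

Lemma contentE (D : {fset box}) (T : {ffun D -> letter}) :
  content T = mkseq (fun i => #|` [fset q in D | (ext T q).1 == i.+1]|) (\max_x (T x).1).
Proof.
apply: eq_mkseq => i; rewrite -card_sep.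
by apply: eq_card => x; rewrite !inE ext_val.
Qed.

(** As the front is nonempty, the largest value of T is one more than that of T', even when the
    inner part is empty and the latter is 0. The other entries of the content shift by one place. *)
Lemma peels_content (D : {fset box}) (T : {ffun D -> letter})
    (T' : {ffun salmasian_inner D -> letter}) :
  D != fset0 -> peels D (ext T) (ext T') ->
  (forall p, p \in salmasian_inner D -> 0 < (ext T' p).1) ->
  content T = #|` salmasian_front D| :: content T'.
Proof.
move=> D0 hp pos'.
have [p pP] : exists p, p \in salmasian_front D.
  by apply/fset0Pn; exact: salmasian_front_neq0.
have pD := fsubsetP (front_sub D) _ pP.
have max1 : 0 < \max_x (T x).1.
  have := leq_bigmax (F := fun x => (T x).1) [` pD].
  by rewrite -{1}ext_val /= hp.2.
have maxE : \max_x (T x).1 = (\max_x (T' x).1).+1.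
  apply/eqP; rewrite eqn_leq; apply/andP; split.
    apply/bigmax_leqP => x _; rewrite -ext_val.
    case: (boolP (val x \in salmasian_inner D)) => [xU|xU].
      rewrite hp.1 //= ltnS -[val x]/(val [` xU]) ext_val.
      exact: (leq_bigmax (F := fun x => (T' x).1)).
    by rewrite hp.2 // front_inner ?fsvalP.
  rewrite -(prednK max1) ltnS; apply/bigmax_leqP => x _.
  have xD := fsubsetP (inner_sub D) _ (fsvalP x).
  have := leq_bigmax (F := fun x => (T x).1) [` xD].
  rewrite -{1}ext_val /= hp.1 ?fsvalP //= ext_val.
  by rewrite -{1}(prednK max1) ltnS.
rewrite !contentE maxE /mkseq /= -add1n iotaDl -map_comp; congr (_ :: _); last first.
  by apply: eq_map => i /=; rewrite (peels_sep_value hp).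
congr #|` _|; apply/fsetP => q; rewrite in_fset_sep.
case: (boolP (q \in D)) => [qD|qD].
  rewrite front_inner //=; case: (boolP (q \in _)) => [qU|qU].
    by rewrite hp.1 //= eqSS eqn0Ngt pos'.
  by rewrite hp.2 // front_inner.
by rewrite (negbTE (contra (fsubsetP (front_sub D) q) qD)).
Qed.

(** The set counted by [amenable_count], for an arbitrary set of boxes, since the sets U_k are skew
    diagrams only up to translation. *)
Definition fillings (D : {fset box}) (kappa : seq nat) :
    {set {ffun D -> 'I_(size kappa).+1 * bool}} :=
  [set t | let T := widen_letters t in
           [&& is_tableau T, amenable (reading_word T) & content T == kappa]].

Lemma fillingsP (D : {fset box}) (kappa : seq nat)
    (t : {ffun D -> 'I_(size kappa).+1 * bool}) :
  reflect [/\ box_tableau D (ext (widen_letters t)),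
              forall k, 1 < k -> box_amenable k D (ext (widen_letters t))
            & content (widen_letters t) = kappa]
    (t \in fillings D kappa).
Proof.
rewrite inE; apply: (iffP and3P).
  by move=> [/box_tableauP h1 /amenableP h2 /eqP h3]; split=> // k /h2/box_amenableP.
move=> [h1 h2 h3]; split; [exact/box_tableauP| |exact/eqP].
by apply/amenableP => k k1; apply/box_amenableP/h2.
Qed.

Lemma ext_widen (m : nat) (D : {fset box}) (t : {ffun D -> 'I_m.+1 * bool}) (x : D) :
  ext (widen_letters t) (val x) = (val (t x).1, (t x).2).
Proof. by rewrite ext_val ffunE. Qed.

Lemma reading_first (P : {fset box}) : P != fset0 ->
  exists2 p, p \in P & forall q, q \in P -> reading_le p q.
Proof.
case/fset0Pn => p; rewrite -mem_reading_seq.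
have := reading_seq_pairwise P; have memP := mem_reading_seq P.
case: (reading_seq P) memP => [//|x s] memP /= /andP[/allP h _] _.
exists x; first by rewrite -memP mem_head.
move=> q; rewrite -memP inE => /orP[/eqP ->|/h/andP[] //].
by rewrite /reading_le lexx eqxx orbT.
Qed.

Lemma reading_le_anti (p q : box) : reading_le p q -> reading_le q p -> p = q.
Proof.
move=> pq qp; apply/eqP; move: pq qp; rewrite box_eqE /reading_le.
by case: p q => [a b] [c d] /=; lia.
Qed.

(** The lower and the left neighbour of a box are both read before it. *)
Lemma first_front_end (D : {fset box}) (p : box) : p \in salmasian_front D ->
  (forall q, q \in salmasian_front D -> reading_le p q) -> p \in front_ends D.
Proof.
move=> pP h; rewrite in_front_ends pP /=; apply/andP; split.
  by apply/negP => /h; rewrite /reading_le /=; lia.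
by apply/negP => /h; rewrite /reading_le /=; lia.
Qed.

Section PeelBack.
Variables (D : {fset box}) (p0 : box).
Hypothesis cvD : shifted_convex D.
Let U := salmasian_inner D.
Let P := salmasian_front D.
Hypothesis p0P : p0 \in P.
Hypothesis p0_first : forall q, q \in P -> reading_le p0 q.
Let A : {fset box} := front_ends D `\ p0.

(** S is the set of free ends, that is ends other than p0, that receive a mark; elsewhere the mark
    is dictated by the box below. *)
Definition front_mark (S : {set A}) (p : box) : bool :=
  (((p.1 + 1)%R, p.2) \in P) || (if insub p is Some y then y \in S else false).

Definition unpeel (m : nat) (S : {set A}) (u : {ffun U -> 'I_m.+1 * bool}) :
    {ffun D -> 'I_m.+2 * bool} :=
  [ffun x => if insub (val x) is Some y then (lift ord0 (u y).1, (u y).2)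
             else (inord 1, front_mark S (val x))].

Section Unpeel.
Variables (m : nat) (S : {set A}) (u : {ffun U -> 'I_m.+1 * bool}).
Let L := ext (widen_letters (unpeel S u)).
Let L' := ext (widen_letters u).

Lemma unpeel_front (p : box) : p \in P -> L p = (1, front_mark S p).
Proof.
move=> pP; have pD := fsubsetP (front_sub D) _ pP.
rewrite /L -[p]/(val [` pD]) ext_widen ffunE insubN /=; first by rewrite inordK.
by rewrite -front_inner.
Qed.

Lemma unpeel_peels : peels D L L'.
Proof.
split=> p pP; last by rewrite unpeel_front.
have pD := fsubsetP (inner_sub D) _ pP.
rewrite /L -[p]/(val [` pD]) ext_widen ffunE insubT /=.
by have := ext_widen u [` pP]; rewrite -/L' /= => ->.
Qed.

Lemma unpeel_front_marked : front_marked D L.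
Proof.
move=> a b pP; rewrite !unpeel_front //= /front_mark /=; split=> [->//|lP].
have /negbTE -> : ((a + 1)%R, b) \notin P.
  by apply/negP => /front_down_left; rewrite -/P lP.
rewrite insubN //= /A in_fsetD1 in_front_ends /= -/P lP !andbF //.
Qed.

Lemma unpeel_first : L p0 = (1, false).
Proof.
rewrite unpeel_front // /front_mark insubN ?orbF; last by rewrite /A in_fsetD1 eqxx.
by have := first_front_end p0P p0_first; rewrite in_front_ends => /and3P[_ /negbTE ->].
Qed.

End Unpeel.

Lemma peels_one (L L' : box -> letter) (p : box) : peels D L L' ->
  (forall q, q \in U -> 0 < (L' q).1) -> p \in D -> ((L p).1 == 1) = (p \in P).
Proof.
move=> hp pos pD; rewrite front_inner //; case: (boolP (p \in _)) => [pU|pU].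
  by rewrite hp.1 //= eqSS eqn0Ngt pos.
by rewrite hp.2 // front_inner.
Qed.

Lemma leftmost_one (L L' : box -> letter) : peels D L L' ->
  (forall q, q \in U -> 0 < (L' q).1) -> L p0 = (1, false) -> leftmost_box D L 1.
Proof.
move=> hp pos L0 x xD x1 hx.
have xP : x \in P by rewrite -(peels_one hp pos) // x1.
have p0D := fsubsetP (front_sub D) _ p0P.
suff -> : x = p0 by [].
by apply: reading_le_anti; [apply: hx => //; rewrite L0|apply: p0_first].
Qed.

Lemma unpeel_fillings (kappa : seq nat) (S : {set A})
    (u : {ffun U -> 'I_(size kappa).+1 * bool}) :
  u \in fillings U kappa -> (unpeel S u : {ffun D -> 'I_(size (#|` P| :: kappa)).+1 * bool})
    \in fillings D (#|` P| :: kappa).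
Proof.
case/fillingsP => tabU amU cU; have hp := unpeel_peels S u.
have pos := bt_pos tabU; have lm1 := leftmost_one hp pos (unpeel_first S u).
have tabD := unpeel_tableau hp cvD (unpeel_front_marked S u) tabU.
apply/fillingsP; split=> //.
  case=> [|[|[|k]]] // _; last by apply/(peels_amenable hp)/amU.
  apply: box_amenable_two => //; first by move=> p pP; exact: hp.2.
  (* The leftmost condition for the value 2 in D is the one for the value 1 in U, a clause of the
     2-amenability of u. *)
  by apply/(peels_leftmost hp); case: (amU 2 isT).
rewrite (peels_content _ hp) ?cU //.
by apply/fset0Pn; exists p0; exact: (fsubsetP (front_sub D)).
Qed.

Lemma unpeel_inj (m : nat) (S S' : {set A}) (u u' : {ffun U -> 'I_m.+1 * bool}) :
  unpeel S u = unpeel S' u' -> (S, u) = (S', u').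
Proof.
move=> e; congr (_, _).
  apply/setP => y; have := fsvalP y; rewrite {2}/A in_fsetD1 in_front_ends.
  case/and4P => _ yP n1 _.
  have := unpeel_front S u yP; rewrite e (unpeel_front S' u' yP) /front_mark.
  by rewrite (negbTE n1) valK => -[].
apply: widen_letters_inj; apply: ext_eq => p pU.
have := (unpeel_peels S u).1 p pU; rewrite e ((unpeel_peels S' u').1 p pU).
by case: (ext _ p) (ext _ p) => [a b] [c d] /= [-> ->].
Qed.

(** A box of value 1 has no diagonal predecessor in D, so it is in the front. The first entry of the
    content says that there are as many such boxes as front boxes, so the two sets coincide. *)
Lemma fillings_one (kappa : seq nat) (t : {ffun D -> 'I_(size (#|` P| :: kappa)).+1 * bool})
    (p : box) :
  t \in fillings D (#|` P| :: kappa) -> p \in D ->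
  ((ext (widen_letters t) p).1 == 1) = (p \in P).
Proof.
case/fillingsP => tabD _; rewrite contentE.
case: (\max_x _) => // n [] cardE _ pD.
have sub : [fset q in D | (ext (widen_letters t) q).1 == 1] `<=` P.
  apply/fsubsetP => -[a b]; rewrite in_fset_sep => /andP[qD /eqP q1].
  rewrite in_front qD; apply/negP => h.
  have := tableau_diag_lt cvD tabD h; rewrite !subrK q1 => /(_ qD).
  by rewrite ltnNge (bt_pos tabD).
have /eqP -> : P == [fset q in D | (ext (widen_letters t) q).1 == 1].
  by rewrite eq_sym eqEfcard sub cardE leqnn.
by rewrite in_fset_sep pD.
Qed.

(** Lowering the inner letters gives u, and the marks at the free ends give S. All other marks are
    forced: by a neighbour in the front, or at p0 by the leftmost condition. *)
Lemma fillings_unpeel (kappa : seq nat)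
    (t : {ffun D -> 'I_(size (#|` P| :: kappa)).+1 * bool}) :
  t \in fillings D (#|` P| :: kappa) ->
  exists S : {set A}, exists2 u : {ffun U -> 'I_(size kappa).+1 * bool},
    u \in fillings U kappa & t = unpeel S u.
Proof.
move=> tF; have one := fillings_one tF; move: tF => /fillingsP[].
set L := ext _ in one * => tabD amD cD.
pose u : {ffun U -> 'I_(size kappa).+1 * bool} :=
  [ffun y => (inord (L (val y)).1.-1, (L (val y)).2)].
pose S := [set y : A | (L (val y)).2].
have hp : peels D L (ext (widen_letters u)).
  split=> p pP; last by apply/eqP; rewrite one // (fsubsetP (front_sub D)).
  have pD := fsubsetP (inner_sub D) _ pP.
  have /= -> := ext_widen u [` pP]; rewrite ffunE /=.
  have L1 : 0 < (L p).1 := bt_pos tabD pD.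
  have Lm : (L p).1 < (size kappa).+2.
    by rewrite /L -[p]/(val [` pD]) ext_widen /=; exact: ltn_ord.
  rewrite inordK ?prednK //; first by case: (L p).
have tabU := peels_tableau hp cvD tabD; have pos := bt_pos tabU.
have D0 : D != fset0 by apply/fset0Pn; exists p0; exact: (fsubsetP (front_sub D)).
exists S, u.
  apply/fillingsP; split=> //.
    by case=> [|[|k]] // _; apply/(peels_amenable hp)/amD.
  by have := peels_content D0 hp pos; rewrite cD => -[].
apply: widen_letters_inj; apply: ext_eq => p pD; rewrite -/L.
case: (boolP (p \in U)) => [pU|pU]; first by rewrite hp.1 // (unpeel_peels S u).1.
have pP : p \in P by rewrite front_inner.
rewrite unpeel_front //; move: (hp.2 p pP); case Lp : (L p) => [l b] /= l1; subst l.
congr (_, _); rewrite /front_mark.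
have hm := tableau_front_marked hp tabD.
case: p Lp pP pU pD => a c Lp pP pU pD; have [h1 h2] := hm _ _ pP.
rewrite Lp /= in h1 h2 *; case: (boolP (_ \in P)) => [/h1 //|n1] /=.
case: insubP => [y _ yE|nA]; first by rewrite inE yE Lp.
move: nA; rewrite /A in_fsetD1 in_front_ends pP n1 /= negb_and !negbK.
case/orP => [/eqP p0E|/h2/negbTE //].
(* The remaining box is p0, the first box of value 1 in reading order; 2-amenability makes its
   letter unmarked. *)
have [_ _ _ lm1] := amD 2 isT.
have p0D := fsubsetP (front_sub D) _ p0P.
have : L p0 = (1, false).
  apply: lm1 => //; first by apply/eqP; rewrite one.
  by move=> y yD /eqP; rewrite one // => /p0_first.
by rewrite -p0E Lp => -[].
Qed.

Lemma card_fillings_peel_at (kappa : seq nat) :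
  #|fillings D (#|` P| :: kappa)| = 2 ^ (num_components P - 1) * #|fillings U kappa|.
Proof.
have -> : fillings D (#|` P| :: kappa) =
    [set (unpeel z.1 z.2 : {ffun D -> 'I_(size (#|` P| :: kappa)).+1 * bool})
       | z in setX [set: {set A}] (fillings U kappa)].
  apply/setP => t; apply/idP/imsetP => [/fillings_unpeel[S [u uF ->]]|[[S u]]].
    by exists (S, u); rewrite // !inE /= in uF *.
  by rewrite in_setX => /andP[_ /= uF] ->; exact: unpeel_fillings.
rewrite card_in_imset; last by move=> [S u] [S' u'] _ _ /unpeel_inj.
rewrite cardsX -powersetT card_powerset cardsT -cardfE num_components_front.
(* Since p0 is itself an end, the number of free ends is the number of components minus one. *)
by rewrite (cardfsD1 p0 (front_ends D)) (first_front_end p0P p0_first) add1n subn1.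
Qed.

End PeelBack.

Lemma card_fillings_peel (D : {fset box}) (kappa : seq nat) :
  shifted_convex D -> D != fset0 ->
  #|fillings D (#|` salmasian_front D| :: kappa)|
    = 2 ^ (num_components (salmasian_front D) - 1) * #|fillings (salmasian_inner D) kappa|.
Proof.
move=> cvD /salmasian_front_neq0/reading_first[p0 p0P p0_first].
exact: (card_fillings_peel_at cvD p0P p0_first).
Qed.

(** * Translations *)

Section Translate.
Variables (a b : int) (D : {fset box}).
Let E := translate a b D.
Let h (p : box) : box := ((p.1 + a)%R, (p.2 + b)%R).

Let h_inj : injective h.
Proof. by move=> [x y] [z t] [] /addIr -> /addIr ->. Qed.

Let mem_h (p : box) : (h p \in E) = (p \in D).
Proof.
by apply/imfsetP/idP => [[q /= qD /h_inj -> //]|pD]; exists p.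
Qed.

Let hx (x : D) : h (val x) \in E.
Proof. by rewrite mem_h fsvalP. Qed.

Let to_E (x : D) : E := [` hx x].

Let to_E_inj : injective to_E.
Proof. by move=> x y [] /addIr e1 /addIr e2; apply/val_inj/eqP; rewrite box_eqE e1 e2 !eqxx. Qed.

Let to_E_surj (y : E) : exists x, y = to_E x.
Proof.
have /imfsetP[p /= pD yE] := fsvalP y.
by exists [` pD]; apply: val_inj.
Qed.

Let to_E_bij : bijective to_E.
Proof.
have inv (y : E) : exists x, y == to_E x by have [x ->] := to_E_surj y; exists x.
have invK y : to_E (xchoose (inv y)) = y by rewrite -(eqP (xchooseP (inv y))).
by exists (fun y => xchoose (inv y)) => // x; apply: to_E_inj; rewrite invK.
Qed.

Let pull (m : nat) (t : {ffun E -> 'I_m.+1 * bool}) : {ffun D -> 'I_m.+1 * bool} :=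
  [ffun x => t (to_E x)].

Let pull_bij (m : nat) : bijective (@pull m).
Proof.
have [of_E toK ofK] := to_E_bij.
exists (fun t : {ffun D -> 'I_m.+1 * bool} => [ffun y => t (of_E y)]) => t.
  by apply/ffunP => y; rewrite !ffunE ofK.
by apply/ffunP => x; rewrite !ffunE toK.
Qed.

Let ext_pull (m : nat) (t : {ffun E -> 'I_m.+1 * bool}) (p : box) : p \in D ->
  ext (widen_letters (pull t)) p = ext (widen_letters t) (h p).
Proof.
move=> pD; have /= -> := ext_widen (pull t) [` pD].
by have /= -> := ext_widen t (to_E [` pD]); rewrite ffunE.
Qed.

(** Translation preserves and reflects the reading order, so it commutes with sorting; reading words
    are then literally equal. *)
Let reading_seq_translate : reading_seq E = map h (reading_seq D).
Proof.
have hmono : {mono h : p q / reading_le p q >-> reading_le p q}.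
  by move=> [x y] [z t]; rewrite /reading_le /= ltrD2r lerD2r (inj_eq (@addIr _ a)).
rewrite /reading_seq (map_sort hmono); apply/perm_sortP => //.
- exact: reading_le_total.
- exact: reading_le_trans.
- by move=> p q /andP[]; exact: reading_le_anti.
apply: uniq_perm; [exact: fset_uniq|by rewrite map_inj_uniq // fset_uniq|].
move=> p; apply/idP/mapP => [/imfsetP[q /= qD ->]|[q qD ->]]; first by exists q.
by rewrite -[_ \in _]/(h q \in E) mem_h.
Qed.

Let tableau_pull (m : nat) (t : {ffun E -> 'I_m.+1 * bool}) :
  is_tableau (widen_letters (pull t)) = is_tableau (widen_letters t).
Proof.
have hE u v : (((u + a)%R, (v + b)%R) \in E) = ((u, v) \in D) := mem_h (u, v).
apply/box_tableauP/box_tableauP => -[pos row col]; split.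
- by move=> _ /imfsetP[q /= qD ->]; rewrite -(ext_pull t qD) pos.
- move=> u v w h1 h2 vw.
  have := row (u - a)%R (v - b)%R (w - b)%R.
  rewrite -!hE !subrK ltrD2r => /(_ h1 h2 vw).
  by rewrite !ext_pull -?hE /h /= ?subrK.
- move=> u v w h1 h2 uv.
  have := col (u - a)%R (v - a)%R (w - b)%R.
  rewrite -!hE !subrK ltrD2r => /(_ h1 h2 uv).
  by rewrite !ext_pull -?hE /h /= ?subrK.
- by move=> p pD; rewrite ext_pull // pos // mem_h.
- by move=> u v w h1 h2 vw; rewrite !ext_pull //; apply: row; rewrite ?hE ?ltrD2r.
- by move=> u v w h1 h2 vw; rewrite !ext_pull //; apply: col; rewrite ?hE ?ltrD2r.
Qed.

Let word_pull (m : nat) (t : {ffun E -> 'I_m.+1 * bool}) :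
  reading_word (widen_letters (pull t)) = reading_word (widen_letters t).
Proof.
rewrite !reading_wordE reading_seq_translate -map_comp; apply/eq_in_map => p.
by rewrite mem_reading_seq => pD; rewrite ext_pull.
Qed.

Let content_pull (m : nat) (t : {ffun E -> 'I_m.+1 * bool}) :
  content (widen_letters (pull t)) = content (widen_letters t).
Proof.
rewrite /content [in RHS](reindex to_E) /=; last exact: onW_bij.
rewrite (eq_bigr (fun x => (widen_letters t (to_E x)).1)); last by move=> x _; rewrite !ffunE.
apply: eq_mkseq => i; rewrite -(on_card_preimset (onW_bij _ to_E_bij)).
by apply: eq_card => x; rewrite !inE !ffunE.
Qed.

Lemma card_fillings_translate (kappa : seq nat) :
  #|fillings (translate a b D) kappa| = #|fillings D kappa|.
Proof.
suff -> : fillings E kappa = @pull (size kappa) @^-1: fillings D kappa.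
  by apply: on_card_preimset; apply: onW_bij; exact: pull_bij.
apply/setP => t; rewrite [RHS]in_set [LHS]in_set [RHS]in_set.
by rewrite /= tableau_pull word_pull content_pull.
Qed.
End Translate.

(** * Iterated peeling *)

Lemma salmasian_U_shifted_convex (D : {fset box}) (k : nat) :
  shifted_convex D -> shifted_convex (salmasian_U D k).
Proof. by rewrite /salmasian_U; elim: k.-1 => //= n IH /IH; exact: inner_shifted_convex. Qed.

Lemma salmasian_U_sub (D : {fset box}) (i j : nat) : i <= j ->
  salmasian_U D j.+1 `<=` salmasian_U D i.+1.
Proof.
elim: j => [|j IH]; first by rewrite leqn0 => /eqP ->.
rewrite leq_eqVlt => /orP[/eqP -> //|/IH]; apply: fsubset_trans; exact: fsubsetDl.
Qed.

(** Each nonempty U_k loses at least one box, so after as many rounds as D has boxes nothing is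
    left, and x was removed in one of the rounds. *)
Lemma salmasian_P_cover (D : {fset box}) (x : box) : x \in D ->
  exists i, x \in salmasian_P D i.+1.
Proof.
move=> xD; have step n : x \in salmasian_U D n.+1 \/ exists i, x \in salmasian_P D i.+1.
  elim: n => [|n [xU|]]; [by left| |by right].
  case: (boolP (x \in salmasian_P D n.+1)) => xP; first by right; exists n.
  by left; rewrite in_fsetD xP.
case: (step #|` D|) => // xU; case: (salmasian_U_card D #|` D|) => [|U0].
  by rewrite -[leqRHS]add0n leq_add2r leqn0 cardfs_eq0 => /eqP U0; rewrite U0 in xU.
by rewrite U0 in xU.
Qed.

Lemma salmasian_T_value (D : {fset box}) (j : nat) (x : D) :
  ((salmasian_T D x).1 == j.+1) = (val x \in salmasian_P D j.+1).
Proof.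
apply/eqP/idP => [|xP]; last by rewrite (salmasian_TE _ xP).
have [i xP] := salmasian_P_cover (fsvalP x).
by rewrite (salmasian_TE _ xP) //= => -[<-].
Qed.

(** The length of the content is the largest value; if U_(j+1) were empty, every box would lie in
    one of P_1, ..., P_j and all values would be at most j. *)
Lemma salmasian_content (D : {fset box}) (j : nat) : j < size (content (salmasian_T D)) ->
  salmasian_U D j.+1 != fset0 /\
  nth 0 (content (salmasian_T D)) j = #|` salmasian_P D j.+1|.
Proof.
rewrite size_mkseq => jm; split; last first.
  rewrite nth_mkseq // -(@card_fsub _ D).
    by apply: eq_card => x; rewrite [LHS]inE [RHS]inE salmasian_T_value.
  exact: fsubset_trans (front_sub _) (salmasian_U_sub D (leq0n j)).
apply/eqP => U0; move: jm; rewrite ltnNge => /negP; apply.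
apply/bigmax_leqP => x _; have [i xP] := salmasian_P_cover (fsvalP x).
rewrite (salmasian_TE _ xP) //= ltnNge; apply/negP => ji.
have := fsubsetP (salmasian_U_sub D ji) _ (fsubsetP (front_sub _) _ xP).
by rewrite U0.
Qed.

Lemma card_fillings_salmasian (D : {fset box}) (k : nat) (kappa : seq nat) :
  shifted_convex D -> k <= size (content (salmasian_T D)) ->
  #|fillings D (take k (content (salmasian_T D)) ++ kappa)|
    = (\prod_(1 <= j < k.+1) 2 ^ (num_components (salmasian_P D j) - 1))
      * #|fillings (salmasian_U D k.+1) kappa|.
Proof.
move=> cvD; elim: k kappa => [|k IH] kappa hk.
  by rewrite take0 big_geq // mul1n.
have [U0 nuk] := salmasian_content hk.
(* The induction hypothesis is applied with the last of the k + 1 parts moved to the head of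
   [kappa]; that part is then peeled off U_(k+1). *)
rewrite (take_nth 0) // cat_rcons IH ?(ltnW hk) // nuk.
rewrite card_fillings_peel //; last exact: salmasian_U_shifted_convex.
by rewrite mulnA [in RHS]big_nat_recr.
Qed.

Theorem lemma3p1 (la mu : seq nat)
    (hla : strict_partition la) (hmu : strict_partition mu)
    (hsub : diagram mu `<=` diagram la)
    (nu : seq nat) (hnu : content (salmasian_T (skew_diagram la mu)) = nu)
    (k : nat) (hk : 1 <= k <= (size nu).+1)
    (alpha beta : seq nat)
    (halpha : strict_partition alpha) (hbeta : strict_partition beta)
    (hsub' : diagram beta `<=` diagram alpha)
    (hU : has_shape (salmasian_U (skew_diagram la mu) k) (skew_diagram alpha beta))
    (gamma : seq nat) (hgamma : strict_partition gamma) :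
  (\prod_(1 <= j < k) 2 ^ (num_components (salmasian_P (skew_diagram la mu) j) - 1))
      * amenable_count alpha beta gamma
    = amenable_count la mu (take k.-1 nu ++ gamma)
  /\ amenable_count alpha beta gamma <= amenable_count la mu (take k.-1 nu ++ gamma).
Proof.
have countE l m g : amenable_count l m g = #|fillings (skew_diagram l m) g| by [].
case: k hk hU => [//|k] hk [a [b hU]]; rewrite !countE /= -hnu.
rewrite card_fillings_salmasian ?hU ?hnu //; last exact: skew_shifted_convex.
rewrite card_fillings_translate; split=> //.
(* The inequality holds because the product of powers of 2 is at least 1. *)
by apply: leq_pmull; apply: prodn_gt0 => j; rewrite expn_gt0.
Qed.
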